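(* Let $\alpha,\beta\in\bigl[\tfrac12,1\bigr]$. The double inequality $$ \overline{C}\bigl(\alpha a+(1-\alpha)b,\ \alpha b+(1-\alpha)a\bigr)<T(a,b)<\overline{C}\bigl(\beta a+(1-\beta)b,\ \beta b+(1-\beta)a\bigr) $$ is valid for all real numbers $a,b>0$ with $a\ne b$ if and only if $$ \alpha\le \frac{1}{2}\Bigl(1+\frac{\sqrt{3}}{2}\Bigr)\quad\text{and}\quad \beta\ge \frac{1}{2}+\frac{1}{2}\sqrt{\frac{12}{\pi}-3}. $$
   Context: For real numbers $a,b>0$, the Toader mean is $$ T(a,b)=\frac{2}{\pi}\int_{0}^{\pi/2}\sqrt{a^2\cos^2\theta+b^2\sin^2\theta}\,d\theta , $$ and the centroidal mean is $$ \overline{C}(a,b)=\frac{2\bigl(a^2+ab+b^2\bigr)}{3(a+b)} . $$ *)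

(* Defs.v *)
From Stdlib Require Import Reals.
From Coquelicot Require Import Coquelicot.
Open Scope R_scope.

(* For all real a and b the integrand is continuous, hence Riemann-integrable,
   so the total operator RInt returns the genuine integral. *)
Definition toader_mean (a b : R) : R :=
  2 / PI *
  RInt (fun theta : R => sqrt (a ^ 2 * cos theta ^ 2 + b ^ 2 * sin theta ^ 2))
       0 (PI / 2).

Definition centroidal_mean (a b : R) : R :=
  2 * (a ^ 2 + a * b + b ^ 2) / (3 * (a + b)).

(* Main.v *)
(** Both means are homogeneous and symmetric, so take [a = 1 + t], [b = 1 - t]
    with [0 < t < 1].  The centroidal means become [1 + (2 g - 1)^2 t^2 / 3] for
    [g = alpha, beta], and the Toader mean is the average of
    [|1 + t e^(2 i theta)| = |(1 + t e^(2 i theta))^(1/2)|^2].  Expanding the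
    square root in the binomial series and integrating termwise (Parseval) gives
    [T (1 + t, 1 - t) = 1 + t^2/4 + t^4/64 + ...] with nonnegative coefficients.
    Hence the remainder [r t = T - 1 - t^2/4] is positive and [r t / t^3] is
    nondecreasing; since [T <= 4/PI], letting [s -> 1] in
    [r t / t^3 <= r s / s^3] yields [0 < r t <= t^3 (4/PI - 5/4)], which gives both
    bounds and the sharpness at [t -> 0].  Sharpness at [t -> 1] comes from
    [T >= (2/PI) (1 + t)]. *)
Require Import Defs.
From Stdlib Require Import Reals Lra Lia.
From Coquelicot Require Import Coquelicot.
Open Scope R_scope.

(** * Binomial coefficients of the square root and their Cauchy square *)

Lemma sum_f_R0_rev (f : nat -> R) (n : nat) :
  sum_f_R0 f n = sum_f_R0 (fun i => f (n - i)%nat) n.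
Proof.
revert f; induction n as [|n IH]; intros f; [reflexivity|].
rewrite (decomp_sum (fun i => f (S n - i)%nat)) by lia.
rewrite tech5, IH.
change (pred (S n)) with n.
change (S n - 0)%nat with (S n).
rewrite Rplus_comm; f_equal.
Qed.

Lemma sum_f_R0_scal (f : nat -> R) (x : R) (n : nat) :
  sum_f_R0 (fun i => x * f i) n = x * sum_f_R0 f n.
Proof. rewrite scal_sum; apply sum_eq; intros; ring. Qed.

(* The generalized binomial coefficient [binomial (1/2, n)]. *)
Fixpoint binom_half (n : nat) : R :=
  match n with
  | O => 1
  | S m => binom_half m * (1 / 2 - INR m) / INR (S m)
  end.

Lemma binom_halfS (n : nat) :
  INR (S n) * binom_half (S n) = (1 / 2 - INR n) * binom_half n.
Proof.
change (binom_half (S n)) with (binom_half n * (1 / 2 - INR n) / INR (S n)).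
field; apply not_0_INR; lia.
Qed.

(** Consecutive coefficients have ratio [|1/2 - n| / (n + 1) <= 1]; geometric majorants then suffice
    for [t < 1]. *)
Lemma binom_half_le1 (n : nat) : Rabs (binom_half n) <= 1.
Proof.
induction n as [|n IH]; [simpl; rewrite Rabs_R1; lra|].
pose proof (pos_INR n) as Hn.
apply Rmult_le_reg_l with (INR (S n)); [apply lt_0_INR; lia|].
rewrite <- (Rabs_pos_eq (INR (S n))) at 1 by apply pos_INR.
rewrite <- Rabs_mult, binom_halfS, Rabs_mult, S_INR.
assert (Rabs (1 / 2 - INR n) <= INR n + 1) by (apply Rabs_le; lra).
pose proof (Rabs_pos (1 / 2 - INR n)); pose proof (Rabs_pos (binom_half n)).
nra.
Qed.

(** Coefficient of [z^n] in the square of the binomial series. *)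
Definition binom_half_conv (n : nat) : R :=
  sum_f_R0 (fun i => binom_half i * binom_half (n - i)) n.

(** The reflection [i -> n - i] fixes the products and turns the weight [i] into [n - i], so two
    copies of the sum carry the constant weight [n]. *)
Lemma binom_half_conv_weighted (n : nat) :
  sum_f_R0 (fun i => INR i * (binom_half i * binom_half (n - i))) n
  = INR n / 2 * binom_half_conv n.
Proof.
set (A := sum_f_R0 _ n).
assert (HA : A + A = INR n * binom_half_conv n).
{ unfold A at 1; rewrite sum_f_R0_rev; unfold A, binom_half_conv.
  rewrite <- sum_plus, <- sum_f_R0_scal.
  apply sum_eq; intros i Hi.
  replace (n - (n - i))%nat with i by lia.
  rewrite minus_INR by lia; ring. }
lra.
Qed.

(* Coefficientwise form of [((1 + z)^(1/2))^2 = 1 + z]. *)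
Lemma binom_half_conv_rec (n : nat) :
  INR (S n) * binom_half_conv (S n) = (1 - INR n) * binom_half_conv n.
Proof.
pose proof (binom_half_conv_weighted (S n)) as H1.
(* The term [i = 0] has weight 0; after an index shift, [binom_halfS] turns the weight [i + 1] into
   [1/2 - i], which brings the sum back to degree [n]. *)
rewrite decomp_sum in H1 by lia.
change (pred (S n)) with n in H1.
rewrite (sum_eq _ (fun i => 1 / 2 * (binom_half i * binom_half (n - i))
   + (-1) * (INR i * (binom_half i * binom_half (n - i))))) in H1.
- rewrite sum_plus, !sum_f_R0_scal, binom_half_conv_weighted in H1.
  fold (binom_half_conv n) in H1.
  rewrite Rmult_0_l in H1.
  nra.
- intros i Hi.
  rewrite <- Rmult_assoc, binom_halfS; simpl (S n - S i)%nat; ring.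
Qed.

Lemma binom_half_conv_ge2 (n : nat) : binom_half_conv (S (S n)) = 0.
Proof.
induction n as [|n IH].
- unfold binom_half_conv; simpl; field.
- pose proof (binom_half_conv_rec (S (S n))) as H; rewrite IH, Rmult_0_r in H.
  apply Rmult_integral in H; destruct H as [H|H]; [|exact H].
  exfalso; revert H; apply not_0_INR; lia.
Qed.

(** * Uniform convergence and termwise integration *)

Lemma series_tail_le (u M : nat -> R) (l L : R) (n : nat) :
  is_series u l -> is_series M L -> (forall k, Rabs (u k) <= M k) ->
  Rabs (l - sum_n u n) <= L - sum_n M n.
Proof.
intros Hu HM Hb.
(* [M - u] and [M + u] have nonnegative terms, so their partial sums stay below their limits; this
   bounds the tail of [u] from both sides. *)
assert (H1 := is_lim_seq_incr_compare _ _ (is_series_minus _ _ _ _ HM Hu)).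
assert (H2 := is_lim_seq_incr_compare _ _ (is_series_plus _ _ _ _ HM Hu)).
assert (H1' : sum_n (fun k => minus (M k) (u k)) n <= minus L l).
{ apply H1; intros k; rewrite sum_Sn.
  pose proof (Hb (S k)) as B; apply Rabs_le_between in B.
  unfold minus, plus, opp; simpl; lra. }
assert (H2' : sum_n (fun k => plus (M k) (u k)) n <= plus L l).
{ apply H2; intros k; rewrite sum_Sn.
  pose proof (Hb (S k)) as B; apply Rabs_le_between in B.
  unfold plus; simpl; lra. }
rewrite sum_n_plus in H2'.
assert (E : sum_n (fun k => minus (M k) (u k)) n = sum_n M n - sum_n u n).
{ rewrite !sum_n_Reals, <- minus_sum; reflexivity. }
rewrite E in H1'.
unfold minus, plus, opp in *; simpl in *.
apply Rabs_le; lra.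
Qed.

Lemma is_RInt_sum (u : nat -> R -> R) (w : nat -> R) (a b : R) (n : nat) :
  (forall k, is_RInt (u k) a b (w k)) ->
  is_RInt (fun x => sum_n (fun k => u k x) n) a b (sum_n w n).
Proof.
intros H; induction n as [|n IH].
- rewrite sum_O; apply is_RInt_ext with (u 0%nat); [|apply H].
  intros x _; now rewrite sum_O.
- rewrite sum_Sn; apply is_RInt_ext with (fun x => plus (sum_n (fun k => u k x) n) (u (S n) x)).
  + intros x _; now rewrite sum_Sn.
  + apply @is_RInt_plus; [exact IH | apply H].
Qed.

(* Weierstrass M-test followed by termwise integration. *)
Lemma is_series_RInt (u : nat -> R -> R) (g : R -> R) (w M : nat -> R) (a b L : R) :
  (forall x, is_series (fun k => u k x) (g x)) ->
  is_series M L -> (forall k x, Rabs (u k x) <= M k) ->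
  (forall k, is_RInt (u k) a b (w k)) ->
  is_series w (RInt g a b).
Proof.
intros Hu HM Hb Hw.
destruct (filterlim_RInt (fun n x => sum_n (fun k => u k x) n) a b eventually _
            g (sum_n w)) as [I [HI1 HI2]].
- intros n; apply is_RInt_sum, Hw.
(* The index [N] comes from the numerical series [M] alone, so it serves all [x] at once. *)
- apply filterlim_locally; intros eps.
  assert (HM' : is_lim_seq (sum_n M) L) by exact HM.
  apply is_lim_seq_spec in HM'.
  destruct (HM' eps) as [N HN]; exists N; intros n Hn x.
  specialize (HN n Hn).
  pose proof (series_tail_le _ _ _ _ n (Hu x) HM (fun k => Hb k x)) as T.
  unfold ball; simpl; unfold AbsRing_ball, abs, minus, plus, opp; simpl.
  rewrite Rabs_minus_sym in T; unfold Rminus in T at 1.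
  apply Rle_lt_trans with (1 := T).
  rewrite Rabs_minus_sym in HN.
  apply Rle_lt_trans with (2 := HN), Rle_abs.
- rewrite (is_RInt_unique _ _ _ _ HI2); exact HI1.
Qed.

(** * Orthogonality of cosines and the Toader coefficients *)

Lemma is_RInt_cos_even (m : Z) :
  is_RInt (fun x => cos (2 * (IZR m * x))) 0 (PI / 2)
    (if Z.eqb m 0 then PI / 2 else 0).
Proof.
destruct (Z.eqb_spec m 0) as [->|Hm].
- apply is_RInt_ext with (fun _ => 1).
  + intros x _; rewrite Rmult_0_l, Rmult_0_r, cos_0; reflexivity.
  + replace (PI / 2) with (scal (PI / 2 - 0) 1) at 2
      by (unfold scal; simpl; unfold mult; simpl; ring).
    apply @is_RInt_const.
- assert (Hm' : IZR m <> 0) by (apply not_0_IZR; exact Hm).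
  set (F := fun x => sin (2 * (IZR m * x)) / (2 * IZR m)).
  replace 0 with (minus (F (PI / 2)) (F 0)) at 2.
  + apply (is_RInt_derive F).
    * intros x _; unfold F; auto_derive; [trivial|field; exact Hm'].
    * intros x _; apply (ex_derive_continuous (fun x => cos (2 * (IZR m * x)))).
      auto_derive; trivial.
  + unfold F, minus, plus, opp; simpl.
    rewrite !Rmult_0_r, sin_0.
    (* The even frequency [2 m] makes the upper endpoint a multiple of [PI]. *)
    rewrite (sin_eq_0_1 (2 * (IZR m * (PI / 2)))) by (exists m; field).
    field; exact Hm'.
Qed.

(* The test selects [i = k - i]: the coefficient is [(binom_half (k / 2))^2]
   for even [k] and [0] for odd [k]. *)
Definition toader_coef (k : nat) : R :=
  sum_f_R0 (fun i => binom_half i * binom_half (k - i)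
                     * (if Z.eqb (Z.of_nat i - Z.of_nat (k - i)) 0 then 1 else 0)) k.

(** Only the diagonal term [i = k - i] survives, and it is a square. *)
Lemma toader_coef_ge0 (k : nat) : 0 <= toader_coef k.
Proof.
apply cond_pos_sum; intros i.
destruct (Z.eqb_spec (Z.of_nat i - Z.of_nat (k - i)) 0) as [H|H]; [|lra].
replace (k - i)%nat with i by lia; nra.
Qed.

(** * Absolute convergence and Cauchy products *)

Definition binom_term (t : R) (n : nat) : R := binom_half n * t ^ n.

(** Cauchy square of the geometric series; it serves as the majorant in the M-test. *)
Lemma is_series_majorant (t : R) (ht : 0 < t < 1) :
  is_series (fun k => sum_f_R0 (fun i => t ^ i * t ^ (k - i)) k) (/ (1 - t) * / (1 - t)).
Proof.
assert (Ht : Rabs t < 1) by (rewrite Rabs_pos_eq; lra).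
assert (Ha : ex_series (fun n => Rabs (t ^ n))).
{ exists (/ (1 - t)); apply is_series_ext with (fun n => t ^ n).
  - intros n; rewrite Rabs_pos_eq; [reflexivity|apply pow_le; lra].
  - apply is_series_geom, Ht. }
apply is_series_mult; try assumption; apply is_series_geom, Ht.
Qed.

Lemma binom_term_le (t : R) (ht : 0 < t < 1) (n : nat) : Rabs (binom_term t n) <= t ^ n.
Proof.
unfold binom_term; rewrite Rabs_mult, (Rabs_pos_eq (t ^ n)) by (apply pow_le; lra).
pose proof (binom_half_le1 n); assert (0 < t ^ n) by (apply pow_lt; lra); nra.
Qed.

Lemma ex_series_binom_term (t : R) (ht : 0 < t < 1) (v : nat -> R) :
  (forall n, Rabs (v n) <= 1) -> ex_series (fun n => Rabs (binom_term t n * v n)).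
Proof.
intros Hv; apply (@ex_series_le R_AbsRing R_CompleteNormedModule) with (fun n => t ^ n).
- intros n; unfold norm; simpl; unfold abs; simpl.
  rewrite Rabs_Rabsolu, Rabs_mult.
  pose proof (binom_term_le t ht n); pose proof (Hv n).
  pose proof (Rabs_pos (binom_term t n)); pose proof (Rabs_pos (v n)); nra.
- exists (/ (1 - t)); apply is_series_geom; rewrite Rabs_pos_eq; lra.
Qed.

(** Absolute convergence justifies the Cauchy product; [v] and [w] stand for cosines or sines of
    multiples of an angle. *)
Lemma is_series_binom_term_mult (t : R) (ht : 0 < t < 1) (v w : nat -> R)
  (hv : forall n, Rabs (v n) <= 1) (hw : forall n, Rabs (w n) <= 1) :
  is_series (fun k => sum_f_R0 (fun i => binom_term t i * v i * (binom_term t (k - i) * w (k - i)%nat)) k)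
    (Series (fun n => binom_term t n * v n) * Series (fun n => binom_term t n * w n)).
Proof.
apply (is_series_mult (fun n => binom_term t n * v n) (fun n => binom_term t n * w n));
  try (apply Series_correct, ex_series_Rabs); apply ex_series_binom_term; assumption.
Qed.

Lemma sum_binom_term_conv (t s : R) (k : nat) :
  sum_f_R0 (fun i => binom_term t i * binom_term t (k - i) * s) k = binom_half_conv k * t ^ k * s.
Proof.
unfold binom_half_conv; rewrite Rmult_assoc, Rmult_comm, <- sum_f_R0_scal.
apply sum_eq; intros i Hi; unfold binom_term.
replace (t ^ k) with (t ^ i * t ^ (k - i)) by (rewrite <- pow_add; f_equal; lia).
ring.
Qed.

(** The coefficients are 1, 1, 0, 0, ..., so partial sums are constant from index 1 on. *)
Lemma is_series_binom_half_conv (t : R) (v : nat -> R) :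
  is_series (fun k => binom_half_conv k * t ^ k * v k) (v 0%nat + t * v 1%nat).
Proof.
assert (H0 : binom_half_conv 0 = 1) by (unfold binom_half_conv; simpl; ring).
assert (H1 : binom_half_conv 1 = 1) by (unfold binom_half_conv; simpl; field).
change (is_lim_seq (sum_n (fun k => binom_half_conv k * t ^ k * v k)) (v 0%nat + t * v 1%nat)).
apply is_lim_seq_ext_loc with (fun _ => v 0%nat + t * v 1%nat); [|apply is_lim_seq_const].
exists 1%nat; intros n Hn; destruct n as [|n]; [lia|clear Hn].
induction n as [|n IH].
- rewrite sum_Sn, sum_O, H0, H1; unfold plus; simpl; ring.
- rewrite sum_Sn, <- IH, binom_half_conv_ge2; unfold plus; simpl; ring.
Qed.

(** * The complex square root and its squared modulus *)

Lemma cos_sin_le1 (x : R) : Rabs (cos x) <= 1 /\ Rabs (sin x) <= 1.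
Proof.
pose proof (COS_bound x); pose proof (SIN_bound x).
split; apply Rabs_le; lra.
Qed.

(* Real and imaginary parts of [(1 + t e^(i p))^(1/2)]. *)
Definition re_half (t p : R) : R := Series (fun n => binom_term t n * cos (INR n * p)).
Definition im_half (t p : R) : R := Series (fun n => binom_term t n * sin (INR n * p)).

(** Real part of [w^2 = 1 + t e^(i p)] for [w = re_half + i im_half]: the cosine addition formula
    collects the two Cauchy products into [binom_half_conv]. *)
Lemma re_half_sq (t p : R) (ht : 0 < t < 1) :
  re_half t p * re_half t p - im_half t p * im_half t p = 1 + t * cos p.
Proof.
assert (Hc : forall n, Rabs (cos (INR n * p)) <= 1) by (intros; apply cos_sin_le1).
assert (Hs : forall n, Rabs (sin (INR n * p)) <= 1) by (intros; apply cos_sin_le1).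
pose proof (is_series_minus _ _ _ _ (is_series_binom_term_mult t ht _ _ Hc Hc)
             (is_series_binom_term_mult t ht _ _ Hs Hs)) as H.
pose proof (is_series_binom_half_conv t (fun k => cos (INR k * p))) as H'.
simpl in H'; rewrite Rmult_0_l, cos_0, Rmult_1_l in H'.
rewrite <- (is_series_unique _ _ H'); symmetry; apply is_series_unique.
apply is_series_ext with (2 := H); intros k.
rewrite <- sum_binom_term_conv; unfold minus, plus, opp; simpl.
fold (Rminus (sum_f_R0 (fun i => binom_term t i * cos (INR i * p) * (binom_term t (k - i) * cos (INR (k - i) * p))) k)
 (sum_f_R0 (fun i => binom_term t i * sin (INR i * p) * (binom_term t (k - i) * sin (INR (k - i) * p))) k)).
rewrite <- minus_sum; apply sum_eq; intros i Hi.
replace (INR k * p) with (INR i * p + INR (k - i) * p)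
  by (rewrite minus_INR by exact Hi; ring).
rewrite cos_plus; ring.
Qed.

(** Imaginary part of the same identity, by the sine addition formula. *)
Lemma im_half_sq (t p : R) (ht : 0 < t < 1) :
  2 * (re_half t p * im_half t p) = t * sin p.
Proof.
assert (Hc : forall n, Rabs (cos (INR n * p)) <= 1) by (intros; apply cos_sin_le1).
assert (Hs : forall n, Rabs (sin (INR n * p)) <= 1) by (intros; apply cos_sin_le1).
pose proof (is_series_plus _ _ _ _ (is_series_binom_term_mult t ht _ _ Hc Hs)
             (is_series_binom_term_mult t ht _ _ Hs Hc)) as H.
pose proof (is_series_binom_half_conv t (fun k => sin (INR k * p))) as H'.
simpl in H'; rewrite Rmult_0_l, sin_0, Rmult_1_l, Rplus_0_l in H'.
rewrite <- (is_series_unique _ _ H').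
replace (2 * (re_half t p * im_half t p))
  with (plus (re_half t p * im_half t p) (im_half t p * re_half t p))
  by (unfold plus; simpl; ring).
symmetry; apply is_series_unique.
apply is_series_ext with (2 := H); intros k.
rewrite <- sum_binom_term_conv; unfold plus; simpl.
rewrite <- sum_plus; apply sum_eq; intros i Hi.
replace (INR k * p) with (INR i * p + INR (k - i) * p)
  by (rewrite minus_INR by exact Hi; ring).
rewrite sin_plus; ring.
Qed.

(* Degree-[k] part in [t] of [|(1 + t e^(2 i x))^(1/2)|^2]. *)
Definition sq_modulus_term (t : R) (k : nat) (x : R) : R :=
  sum_f_R0 (fun i => binom_term t i * binom_term t (k - i)
     * cos (2 * (IZR (Z.of_nat i - Z.of_nat (k - i)) * x))) k.

(** Multiplying [w] by its conjugate produces cosines of angle differences and sums to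
    [|w|^2 = |w^2|], the modulus of [1 + t e^(2 i x)], which is the Toader integrand. *)
Lemma is_series_sq_modulus (t x : R) (ht : 0 < t < 1) :
  is_series (fun k => sq_modulus_term t k x)
    (sqrt ((1 + t) ^ 2 * cos x ^ 2 + (1 - t) ^ 2 * sin x ^ 2)).
Proof.
set (p := 2 * x).
assert (Hc : forall n, Rabs (cos (INR n * p)) <= 1) by (intros; apply cos_sin_le1).
assert (Hs : forall n, Rabs (sin (INR n * p)) <= 1) by (intros; apply cos_sin_le1).
pose proof (is_series_plus _ _ _ _ (is_series_binom_term_mult t ht _ _ Hc Hc)
             (is_series_binom_term_mult t ht _ _ Hs Hs)) as H.
fold (re_half t p) (im_half t p) in H.
replace (sqrt _) with (re_half t p * re_half t p + im_half t p * im_half t p).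
- apply is_series_ext with (2 := H); intros k.
  unfold plus; simpl; rewrite <- sum_plus; apply sum_eq; intros i Hi.
  rewrite minus_IZR, <- !INR_IZR_INZ.
  replace (2 * ((INR i - INR (k - i)) * x)) with (INR i * p - INR (k - i) * p)
    by (unfold p; ring).
  rewrite cos_minus; ring.
- symmetry; apply sqrt_lem_1.
  + apply Rplus_le_le_0_compat; apply Rmult_le_pos; apply pow2_ge_0.
  + apply Rplus_le_le_0_compat; apply Rle_0_sqr.
  + pose proof (re_half_sq t p ht) as E1; pose proof (im_half_sq t p ht) as E2.
    set (X := re_half t p) in *; set (Y := im_half t p) in *.
    (* Multiplicativity of the modulus, [|w|^4 = |w^2|^2], in real coordinates. *)
    replace ((X * X + Y * Y) * (X * X + Y * Y))
      with ((X * X - Y * Y) ^ 2 + (2 * (X * Y)) ^ 2) by ring.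
    replace (X * X - Y * Y) with (1 + t * cos p) by (symmetry; exact E1).
    replace (2 * (X * Y)) with (t * sin p) by (symmetry; exact E2).
    unfold p; rewrite cos_2a, sin_2a.
    pose proof (sin2_cos2 x) as E; unfold Rsqr in E.
    set (c := cos x) in *; set (s := sin x) in *.
    replace ((1 + t * (c * c - s * s)) ^ 2 + (t * (2 * s * c)) ^ 2)
      with (1 + 2 * t * (c * c - s * s) + t ^ 2 * (s * s + c * c) ^ 2) by ring.
    rewrite E; replace 1 with (s * s + c * c) at 1 by exact E.
    replace (t ^ 2 * 1 ^ 2) with (t ^ 2 * (s * s + c * c)) by (rewrite E; ring).
    ring.
Qed.

Lemma is_RInt_sq_modulus_term (t : R) (k : nat) :
  is_RInt (sq_modulus_term t k) 0 (PI / 2) (PI / 2 * (toader_coef k * t ^ k)).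
Proof.
apply is_RInt_ext with (fun x => sum_n (fun i => binom_term t i * binom_term t (k - i)
     * cos (2 * (IZR (Z.of_nat i - Z.of_nat (k - i)) * x))) k).
{ intros x _; rewrite sum_n_Reals; reflexivity. }
replace (PI / 2 * (toader_coef k * t ^ k)) with (sum_n (fun i => binom_term t i * binom_term t (k - i)
     * (if Z.eqb (Z.of_nat i - Z.of_nat (k - i)) 0 then PI / 2 else 0)) k).
- apply is_RInt_sum; intros i.
  apply (is_RInt_scal (V := R_NormedModule)), is_RInt_cos_even.
- rewrite sum_n_Reals; unfold toader_coef.
  replace (PI / 2 * _) with (t ^ k * PI / 2 * toader_coef k) by (unfold toader_coef; field).
  unfold toader_coef; rewrite <- sum_f_R0_scal; apply sum_eq; intros i Hi.
  replace (t ^ k) with (t ^ i * t ^ (k - i)) by (rewrite <- pow_add; f_equal; lia).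
  unfold binom_term; destruct (Z.eqb _ _); field.
Qed.

(** * Power series of the Toader mean and its remainder *)

Lemma is_series_toader (t : R) (ht : 0 < t < 1) :
  is_series (fun k => toader_coef k * t ^ k) (toader_mean (1 + t) (1 - t)).
Proof.
assert (H : is_series (fun k => PI / 2 * (toader_coef k * t ^ k))
  (RInt (fun x => sqrt ((1 + t) ^ 2 * cos x ^ 2 + (1 - t) ^ 2 * sin x ^ 2)) 0 (PI / 2))).
{ apply (is_series_RInt (sq_modulus_term t)) with (2 := is_series_majorant t ht).
  - intros x; apply is_series_sq_modulus, ht.
  - intros k x; unfold sq_modulus_term.
    apply Rle_trans with (1 := Rsum_abs _ _); apply sum_Rle; intros i Hi.
    rewrite !Rabs_mult.
    pose proof (binom_term_le t ht i) as A; pose proof (binom_term_le t ht (k - i)) as B.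
    pose proof (Rabs_pos (binom_term t i)); pose proof (Rabs_pos (binom_term t (k - i))).
    rewrite <- (Rmult_1_r (t ^ i * t ^ (k - i))).
    apply Rmult_le_compat; [nra|apply Rabs_pos| |apply cos_sin_le1].
    apply Rmult_le_compat; assumption.
  - intros k; apply is_RInt_sq_modulus_term. }
apply (is_series_scal_l (2 / PI)) in H.
apply is_series_ext with (2 := H); intros k.
unfold scal; simpl; unfold mult; simpl; field; apply PI_neq0.
Qed.

Lemma toader_coef_values :
  toader_coef 0 = 1 /\ toader_coef 1 = 0 /\ toader_coef 2 = 1 / 4
  /\ toader_coef 3 = 0 /\ toader_coef 4 = 1 / 64.
Proof. unfold toader_coef; repeat split; simpl; field. Qed.

Definition toader_rem (t : R) : R := toader_mean (1 + t) (1 - t) - 1 - t ^ 2 / 4.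

(** The subtracted polynomial is exactly the part of degree at most 2, so every remaining term
    carries a factor [t^3]. *)
Lemma is_series_toader_rem (t : R) (ht : 0 < t < 1) :
  is_series (fun k => toader_coef (k + 3) * t ^ (k + 3)) (toader_rem t).
Proof.
destruct toader_coef_values as (E0 & E1 & E2 & _).
apply is_series_ext with (fun k => toader_coef (3 + k) * t ^ (3 + k)).
{ intros k; now rewrite Nat.add_comm. }
apply (is_series_incr_n (fun k => toader_coef k * t ^ k)); [lia|].
replace (plus _ _) with (toader_mean (1 + t) (1 - t)); [apply is_series_toader, ht|].
rewrite sum_n_Reals; unfold toader_rem, plus; simpl; rewrite E0, E1, E2; field.
Qed.

Lemma toader_rem_gt0 (t : R) (ht : 0 < t < 1) : 0 < toader_rem t.
Proof.
pose proof (is_series_toader_rem t ht) as H.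
destruct toader_coef_values as (_ & _ & _ & E3 & E4).
(* Summing up to index 1 reaches degree 4, whose term [t^4 / 64] is positive. *)
apply Rlt_le_trans with (sum_n (fun k => toader_coef (k + 3) * t ^ (k + 3)) 1).
- rewrite sum_Sn, sum_O; unfold plus; simpl (_ + 3)%nat; rewrite E3, E4.
  assert (0 < t ^ 4) by (apply pow_lt; lra); simpl in *; lra.
- apply (is_lim_seq_incr_compare _ (toader_rem t)); [exact H|intros n].
  rewrite sum_Sn; unfold plus; cbn [AbelianMonoid.plus].
  assert (0 <= toader_coef (S n + 3) * t ^ (S n + 3)).
  { apply Rmult_le_pos; [apply toader_coef_ge0|apply pow_le; lra]. }
  simpl in *; lra.
Qed.

(** Monotonicity of [toader_rem t / t^3], a power series with nonnegative coefficients,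
    cross-multiplied and compared term by term. *)
Lemma toader_rem_cube_incr (t s : R) (ht : 0 < t) (hts : t < s) (hs : s < 1) :
  s ^ 3 * toader_rem t <= t ^ 3 * toader_rem s.
Proof.
pose proof (is_series_toader_rem t ltac:(lra)) as Ht.
pose proof (is_series_toader_rem s ltac:(lra)) as Hs.
apply (is_series_scal_l (s ^ 3)) in Ht; apply (is_series_scal_l (t ^ 3)) in Hs.
change (is_lim_seq (sum_n (fun k => s ^ 3 * (toader_coef (k + 3) * t ^ (k + 3))))
          (s ^ 3 * toader_rem t)) in Ht.
change (is_lim_seq (sum_n (fun k => t ^ 3 * (toader_coef (k + 3) * s ^ (k + 3))))
          (t ^ 3 * toader_rem s)) in Hs.
assert (H : Rbar_le (s ^ 3 * toader_rem t) (t ^ 3 * toader_rem s)); [|exact H].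
refine (is_lim_seq_le _ _ _ _ _ Ht Hs); intros n.
rewrite !sum_n_Reals; apply sum_Rle; intros k _.
rewrite !pow_add.
pose proof (toader_coef_ge0 (k + 3)).
assert (t ^ k <= s ^ k) by (apply pow_incr; lra).
assert (0 < t ^ 3 * s ^ 3) by (apply Rmult_lt_0_compat; apply pow_lt; lra).
replace (s ^ 3 * (toader_coef (k + 3) * (t ^ k * t ^ 3)))
  with (toader_coef (k + 3) * (t ^ 3 * s ^ 3) * t ^ k) by ring.
replace (t ^ 3 * (toader_coef (k + 3) * (s ^ k * s ^ 3)))
  with (toader_coef (k + 3) * (t ^ 3 * s ^ 3) * s ^ k) by ring.
apply Rmult_le_compat_l; [apply Rmult_le_pos; lra|assumption].
Qed.

(** * Elementary bounds, symmetry and homogeneity of the Toader mean *)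

Lemma toader_continuous (a b x : R) :
  continuous (fun theta => sqrt (a ^ 2 * cos theta ^ 2 + b ^ 2 * sin theta ^ 2)) x.
Proof.
apply continuous_comp with (g := sqrt); [|apply continuous_sqrt].
apply (ex_derive_continuous (fun theta => a ^ 2 * cos theta ^ 2 + b ^ 2 * sin theta ^ 2)).
auto_derive; trivial.
Qed.

Lemma toader_ex_RInt (a b u v : R) :
  ex_RInt (fun theta => sqrt (a ^ 2 * cos theta ^ 2 + b ^ 2 * sin theta ^ 2)) u v.
Proof.
apply (ex_RInt_continuous (V := R_CompleteNormedModule)).
intros x _; apply toader_continuous.
Qed.

Lemma is_RInt_cos_sin (a b : R) :
  is_RInt (fun x => a * cos x + b * sin x) 0 (PI / 2) (a + b).
Proof.
replace (a + b) with (minus (a * sin (PI / 2) - b * cos (PI / 2)) (a * sin 0 - b * cos 0)).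
- apply (is_RInt_derive (fun x => a * sin x - b * cos x)).
  + intros x _; auto_derive; [trivial|ring].
  + intros x _; apply (ex_derive_continuous (fun x => a * cos x + b * sin x)).
    auto_derive; trivial.
- rewrite sin_PI2, cos_PI2, sin_0, cos_0; unfold minus, plus, opp; simpl; ring.
Qed.

Lemma cos_sin_ge0 (x : R) : 0 < x < PI / 2 -> 0 <= cos x /\ 0 <= sin x.
Proof.
pose proof PI_RGT_0; intros Hx.
split; [apply cos_ge_0|apply sin_ge_0]; lra.
Qed.

(** Uses [sqrt (u^2 + v^2) <= u + v] for [u, v >= 0]. At [(1 + s, 1 - s)] the bound is [4 / PI] for
    every [s]. *)
Lemma toader_le (a b : R) (ha : 0 <= a) (hb : 0 <= b) :
  toader_mean a b <= 2 / PI * (a + b).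
Proof.
pose proof PI_RGT_0; unfold toader_mean.
apply Rmult_le_compat_l; [apply Rlt_le, Rdiv_lt_0_compat; lra|].
rewrite <- (is_RInt_unique _ _ _ _ (is_RInt_cos_sin a b)).
apply RInt_le; [lra|apply toader_ex_RInt|eexists; apply is_RInt_cos_sin|].
intros x Hx; destruct (cos_sin_ge0 x Hx) as [Hc Hs].
assert (0 <= a * cos x) by (apply Rmult_le_pos; assumption).
assert (0 <= b * sin x) by (apply Rmult_le_pos; assumption).
rewrite <- (sqrt_Rsqr (a * cos x + b * sin x)) by lra.
apply sqrt_le_1_alt; unfold Rsqr; nra.
Qed.

(** The sine term under the root is dropped; at [(1 + t, 1 - t)] this loses nothing in the limit
    [t -> 1]. *)
Lemma toader_ge (a b : R) (ha : 0 <= a) : 2 / PI * a <= toader_mean a b.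
Proof.
pose proof PI_RGT_0; unfold toader_mean.
apply Rmult_le_compat_l; [apply Rlt_le, Rdiv_lt_0_compat; lra|].
replace a with (a + 0) at 1 by ring.
rewrite <- (is_RInt_unique _ _ _ _ (is_RInt_cos_sin a 0)).
apply RInt_le; [lra|eexists; apply is_RInt_cos_sin|apply toader_ex_RInt|].
intros x Hx; destruct (cos_sin_ge0 x Hx) as [Hc Hs].
assert (0 <= a * cos x) by (apply Rmult_le_pos; assumption).
rewrite Rmult_0_l, Rplus_0_r.
rewrite <- (sqrt_Rsqr (a * cos x)) by lra.
apply sqrt_le_1_alt; unfold Rsqr.
pose proof (pow2_ge_0 (b * sin x)); nra.
Qed.

Lemma toader_sym (a b : R) : toader_mean a b = toader_mean b a.
Proof.
unfold toader_mean; f_equal.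
set (f := fun theta => sqrt (b ^ 2 * cos theta ^ 2 + a ^ 2 * sin theta ^ 2)).
(* Prepares the substitution [x -> PI / 2 - x], which exchanges cosine and sine; the sign comes from
   the reversed orientation. *)
assert (E : is_RInt f (-1 * 0 + PI / 2) (-1 * (PI / 2) + PI / 2) (- RInt f 0 (PI / 2))).
{ replace (-1 * 0 + PI / 2) with (PI / 2) by ring.
  replace (-1 * (PI / 2) + PI / 2) with 0 by ring.
  apply (is_RInt_swap (V := R_NormedModule)), (RInt_correct (V := R_CompleteNormedModule)), toader_ex_RInt. }
apply is_RInt_comp_lin in E; apply (is_RInt_scal _ _ _ (-1)) in E.
rewrite <- (Ropp_involutive (RInt f 0 (PI / 2))).
replace (- - RInt f 0 (PI / 2)) with (scal (-1) (- RInt f 0 (PI / 2)))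
  by (unfold scal; simpl; unfold mult; simpl; ring).
apply is_RInt_unique; revert E; apply is_RInt_ext; intros x _.
unfold scal; simpl; unfold mult; simpl; unfold f.
replace (-1 * x + PI / 2) with (PI / 2 - x) by ring.
rewrite cos_shift, sin_shift, <- Rmult_assoc.
replace (-1 * -1) with 1 by ring; rewrite Rmult_1_l; f_equal; ring.
Qed.

Lemma toader_homog (c a b : R) (hc : 0 <= c) :
  toader_mean (c * a) (c * b) = c * toader_mean a b.
Proof.
unfold toader_mean.
rewrite <- (Rmult_assoc c), (Rmult_comm c (2 / PI)), (Rmult_assoc (2 / PI)); f_equal.
apply is_RInt_unique.
apply is_RInt_ext with
  (fun x => scal c (sqrt (a ^ 2 * cos x ^ 2 + b ^ 2 * sin x ^ 2))).
- intros x _.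
  change (c * sqrt (a ^ 2 * cos x ^ 2 + b ^ 2 * sin x ^ 2)
          = sqrt ((c * a) ^ 2 * cos x ^ 2 + (c * b) ^ 2 * sin x ^ 2)).
  replace ((c * a) ^ 2 * cos x ^ 2 + (c * b) ^ 2 * sin x ^ 2)
    with (c ^ 2 * (a ^ 2 * cos x ^ 2 + b ^ 2 * sin x ^ 2)) by ring.
  rewrite sqrt_mult_alt, sqrt_pow2; [reflexivity|exact hc|apply pow2_ge_0].
- apply (is_RInt_scal (V := R_NormedModule)),
    (RInt_correct (V := R_CompleteNormedModule)), toader_ex_RInt.
Qed.

(** * Sharp bounds from the limit at 1 *)

Lemma le_of_left_limit (f : R -> R) (c t : R) :
  continuous f 1 -> t < 1 -> (forall s, t < s < 1 -> f s <= c) -> f 1 <= c.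
Proof.
intros Hf Ht H; apply Rnot_lt_le; intros Hlt.
assert (He : 0 < f 1 - c) by lra.
pose proof (proj1 (filterlim_locally _ _) Hf (mkposreal _ He)) as [d Hd].
pose proof (cond_pos d) as Hd0.
(* This point lies in [(t, 1)] and within [d] of 1. *)
set (s := Rmax ((t + 1) / 2) (1 - d / 2)).
assert (Hs : t < s < 1).
{ unfold s; split; [pose proof (Rmax_l ((t + 1) / 2) (1 - d / 2)); lra|].
  apply Rmax_lub_lt; lra. }
assert (Hb : 1 - d / 2 <= s) by apply Rmax_r.
assert (B : ball (f 1) (f 1 - c) (f s)).
{ apply Hd; unfold ball; simpl; unfold AbsRing_ball, abs, minus, plus, opp; simpl.
  apply Rabs_lt_between; lra. }
unfold ball in B; simpl in B; unfold AbsRing_ball, abs, minus, plus, opp in B; simpl in B.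
apply Rabs_lt_between in B; specialize (H s Hs); lra.
Qed.

(** Monotonicity compares [t] with [s], [toader_le] bounds the remainder at [s], and only the
    resulting polynomial inequality in [s] is taken to [s = 1]. *)
Lemma toader_rem_upper (t : R) (ht : 0 < t < 1) :
  toader_rem t <= t ^ 3 * (4 / PI - 5 / 4).
Proof.
pose proof PI_RGT_0 as Hpi.
enough (1 ^ 3 * toader_rem t - t ^ 3 * (4 / PI - 1 - 1 ^ 2 / 4) <= 0) by lra.
apply (le_of_left_limit
  (fun s => s ^ 3 * toader_rem t - t ^ 3 * (4 / PI - 1 - s ^ 2 / 4)) 0 t).
- apply (ex_derive_continuous
    (fun s => s ^ 3 * toader_rem t - t ^ 3 * (4 / PI - 1 - s ^ 2 / 4))).
  auto_derive; trivial.
- lra.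
- intros s Hs.
  pose proof (toader_rem_cube_incr t s ltac:(lra) ltac:(lra) ltac:(lra)) as H.
  pose proof (toader_le (1 + s) (1 - s) ltac:(lra) ltac:(lra)) as H'.
  replace (2 / PI * (1 + s + (1 - s))) with (4 / PI) in H' by (field; lra).
  assert (0 < t ^ 3) by (apply pow_lt; lra).
  assert (t ^ 3 * toader_rem s <= t ^ 3 * (4 / PI - 1 - s ^ 2 / 4)).
  { apply Rmult_le_compat_l; [lra|unfold toader_rem; lra]. }
  lra.
Qed.

Lemma toader_lower_bound (t : R) (ht : 0 < t < 1) :
  1 + t ^ 2 / 4 < toader_mean (1 + t) (1 - t).
Proof. pose proof (toader_rem_gt0 t ht); unfold toader_rem in *; lra. Qed.

Lemma toader_upper_bound (t : R) (ht : 0 < t < 1) :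
  toader_mean (1 + t) (1 - t) < 1 + (4 / PI - 1) * t ^ 2.
Proof.
pose proof (toader_rem_gt0 t ht) as H0; pose proof (toader_rem_upper t ht) as H1.
unfold toader_rem in *.
assert (0 < t ^ 3) by (apply pow_lt; lra).
(* Positivity follows from [0 < toader_rem t <= t^3 (4/PI - 5/4)], without a numerical estimate of
   [PI]. *)
assert (0 < 4 / PI - 5 / 4) by nra.
assert (t ^ 3 < t ^ 2) by (simpl; nra).
nra.
Qed.

(** * Normalization and the equivalence *)

Lemma centroidal_mean_mix (g c t : R) (hc : 0 < c) :
  centroidal_mean (g * (c * (1 + t)) + (1 - g) * (c * (1 - t)))
                  (g * (c * (1 - t)) + (1 - g) * (c * (1 + t)))
  = c * (1 + (2 * g - 1) ^ 2 / 3 * t ^ 2).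
(* The arguments are [c (1 + u)] and [c (1 - u)] with [u = (2 g - 1) t]. *)
Proof. unfold centroidal_mean; field; lra. Qed.

Lemma mean_bounds_normalize (alpha beta : R) :
  (forall a b : R, 0 < a -> 0 < b -> a <> b ->
     centroidal_mean (alpha * a + (1 - alpha) * b) (alpha * b + (1 - alpha) * a)
       < toader_mean a b
     /\ toader_mean a b
       < centroidal_mean (beta * a + (1 - beta) * b) (beta * b + (1 - beta) * a))
  <->
  (forall t, 0 < t < 1 ->
     1 + (2 * alpha - 1) ^ 2 / 3 * t ^ 2 < toader_mean (1 + t) (1 - t)
       < 1 + (2 * beta - 1) ^ 2 / 3 * t ^ 2).
Proof.
split; intros H.
- intros t ht.
  destruct (H (1 * (1 + t)) (1 * (1 - t))) as [H1 H2]; try lra.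
  rewrite centroidal_mean_mix in H1, H2 by lra.
  rewrite !Rmult_1_l in H1, H2; lra.
- assert (K : forall a b, 0 < b -> b < a ->
     centroidal_mean (alpha * a + (1 - alpha) * b) (alpha * b + (1 - alpha) * a)
       < toader_mean a b
     /\ toader_mean a b
       < centroidal_mean (beta * a + (1 - beta) * b) (beta * b + (1 - beta) * a)).
  { intros a b hb hab.
    (* Chosen so that [a = c (1 + t)] and [b = c (1 - t)]. *)
    set (c := (a + b) / 2); set (t := (a - b) / (a + b)).
    assert (hc : 0 < c) by (unfold c; lra).
    assert (ht : 0 < t < 1).
    { unfold t; split; [apply Rdiv_lt_0_compat; lra|].
      apply Rmult_lt_reg_r with (a + b); [lra|]; field_simplify; lra. }
    replace a with (c * (1 + t)) by (unfold c, t; field; lra).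
    replace b with (c * (1 - t)) by (unfold c, t; field; lra).
    rewrite !centroidal_mean_mix, toader_homog by lra.
    destruct (H t ht); split; apply Rmult_lt_compat_l; assumption. }
  intros a b ha hb hab.
  destruct (Rtotal_order a b) as [Hlt|[Heq|Hgt]]; [|contradiction|apply K; assumption].
  rewrite toader_sym.
  destruct (K b a ha Hlt) as [H1 H2].
  unfold centroidal_mean in *.
  split.
  + eapply Rle_lt_trans; [|exact H1]; right; f_equal; f_equal; ring.
  + eapply Rlt_le_trans; [exact H2|]; right; f_equal; f_equal; ring.
Qed.

Theorem theorem1 (alpha beta : R)
  (halpha : 1 / 2 <= alpha <= 1) (hbeta : 1 / 2 <= beta <= 1) :
  (forall a b : R, 0 < a -> 0 < b -> a <> b ->
     centroidal_mean (alpha * a + (1 - alpha) * b) (alpha * b + (1 - alpha) * a)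
       < toader_mean a b
     /\ toader_mean a b
       < centroidal_mean (beta * a + (1 - beta) * b) (beta * b + (1 - beta) * a))
  <->
  (alpha <= 1 / 2 * (1 + sqrt 3 / 2)
   /\ beta >= 1 / 2 + 1 / 2 * sqrt (12 / PI - 3)).
Proof.
rewrite mean_bounds_normalize.
pose proof PI_RGT_0 as Hpi.
pose proof (sqrt_pos 3) as S0; pose proof (sqrt_sqrt 3 ltac:(lra)) as S3.
assert (H12 : 12 / PI - 3 = 3 * (4 / PI - 1)) by (field; lra).
split.
- intros H; split.
  + enough (2 * alpha - 1 <= sqrt 3 / 2) by lra.
    apply Rnot_lt_le; intros Hlt.
    (* Excess of the centroidal coefficient of [t^2] over the Toader one. The bounds give
       [x t^2 < toader_rem t <= t^3 K], which must fail for small [t]. *)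
    set (x := (2 * alpha - 1) ^ 2 / 3 - 1 / 4).
    assert (Hx : 0 < x) by (unfold x; nra).
    set (K := 4 / PI - 5 / 4).
    assert (HK : forall t, 0 < t < 1 -> x < t * K).
    { intros t ht; destruct (H t ht) as [H1 _].
      pose proof (toader_rem_upper t ht) as H2; fold K in H2; unfold toader_rem in H2.
      assert (0 < t ^ 2) by (apply pow_lt; lra).
      apply Rmult_lt_reg_l with (t ^ 2); [assumption|].
      replace (t ^ 2 * (t * K)) with (t ^ 3 * K) by ring.
      unfold x; lra. }
    assert (HK0 : x < K) by (pose proof (HK (1 / 2) ltac:(lra)); lra).
    (* At [t = x / K] the inequality [x < t K] reads [x < x]. *)
    assert (Hxk : 0 < x / K < 1).
    { split; [apply Rdiv_lt_0_compat; lra|].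
      apply Rmult_lt_reg_r with K; [lra|]; field_simplify; lra. }
    pose proof (HK (x / K) Hxk) as F.
    replace (x / K * K) with x in F by (field; lra); lra.
  + apply Rle_ge.
    enough (sqrt (12 / PI - 3) <= 2 * beta - 1) by lra.
    rewrite <- (sqrt_pow2 (2 * beta - 1)) by lra.
    apply sqrt_le_1_alt; rewrite H12.
    (* The limit [t -> 1] of [2/PI (1 + t) < 1 + (2 beta - 1)^2 t^2 / 3], which follows from
       [toader_ge]. *)
    enough (2 / PI * (1 + 1) - (2 * beta - 1) ^ 2 / 3 * 1 ^ 2 <= 1).
    { replace (4 / PI) with (2 / PI * (1 + 1)) by (field; lra); lra. }
    apply (le_of_left_limit
      (fun t => 2 / PI * (1 + t) - (2 * beta - 1) ^ 2 / 3 * t ^ 2) 1 0); [|lra|].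
    * apply (ex_derive_continuous
        (fun t => 2 / PI * (1 + t) - (2 * beta - 1) ^ 2 / 3 * t ^ 2)).
      auto_derive; trivial.
    * intros t ht; destruct (H t ht) as [_ H2].
      pose proof (toader_ge (1 + t) (1 - t) ltac:(lra)); lra.
- intros [Ha Hb] t ht.
  assert (T2 : 0 < t ^ 2) by (apply pow_lt; lra).
  split.
  + apply Rle_lt_trans with (2 := toader_lower_bound t ht).
    assert ((2 * alpha - 1) ^ 2 / 3 <= 1 / 4) by nra.
    nra.
  + apply Rlt_le_trans with (1 := toader_upper_bound t ht).
    assert (Hs : 12 / PI - 3 <= (2 * beta - 1) ^ 2).
    { apply Rnot_lt_le; intros Hlt; pose proof (sqrt_lt_1_alt _ _ (conj (pow2_ge_0 _) Hlt)) as Hr.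
      rewrite sqrt_pow2 in Hr by lra; lra. }
    rewrite H12 in Hs; nra.
Qed.
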